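(* Let $0<c<1/10$. Then there exists $n_0$ such that for every $n\ge n_0$ the following holds. If $\mathcal{M}=\{M_1,\ldots,M_m\}$ is a non-intersecting family of $m\le (1-n^{-c})n$ matchings, each of size $n$, then $\mathcal{M}$ contains a full rainbow matching.
   Context: A family $\mathcal{M}=\{M_1,\ldots,M_m\}$ of matchings (sets of pairwise vertex-disjoint edges on a common vertex set) is non-intersecting if $M_i\cap M_j=\emptyset$ for all $1\le i<j\le m$, i.e. the graph whose edge set is $\bigcup_i M_i$ is simple. A full rainbow matching is a matching $M\subseteq\bigcup_i M_i$ containing exactly one edge from $M_i$ for each $1\le i\le m$. *)

(* Defs.v *)
From mathcomp Require Import all_boot.

Set Implicit Arguments.
Unset Strict Implicit.
Unset Printing Implicit Defensive.

Section Matchings.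
Variable T : finType.
Implicit Types (M : {set {set T}}) (m : nat).

(* Edges on the vertex set T are the 2-element subsets of T. *)
Definition matching M : bool :=
  [forall e in M, #|e| == 2] && trivIset M.

Definition non_intersecting m (F : 'I_m -> {set {set T}}) : Prop :=
  forall i j : 'I_m, i < j -> F i :&: F j = set0.

Definition full_rainbow_matching m (F : 'I_m -> {set {set T}}) M : Prop :=
  [/\ matching M,
      M \subset \bigcup_(i < m) F i
    & forall i : 'I_m, #|M :&: F i| = 1].

End Matchings.

(* Main.v *)
(* Reserve a random vertex set, the reservoir, containing each vertex with
   probability 1/N, where N = n^c up to a constant.  By Chebyshev's inequality
   all but O(N^2) colours have at least n/(2N^2) edges inside it and at most 4n/N
   vertices in it; the exceptional colours are matched greedily.  Off the
   reservoir every other colour still has more edges than there are colours, by a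
   margin 2D of order n^(1-c).  An augmenting argument gives there a rainbow
   matching that misses only O(n^(2c)) colours, and these are finally matched
   greedily inside the reservoir, as n^(2c) is much smaller than n/N^2.

   Augmenting argument.  Starting from the uncovered vertices, grow a set W of
   vertices that can be released: if xy is a matching edge and x is joined to W
   by many edges of missing colours, then y can be released by exchanging xy for
   such an edge wx and releasing w recursively.  Every release has many choices
   at each step, so two of them can be carried out with disjoint vertices and
   colours even though all use the same pool of missing colours.  Hence if no
   augmentation exists, missing colours have no edge inside W, and counting
   their edges shows that each step makes W meet D further edges of the matching;
   this cannot go on for more than m/D steps. *)
Require Import Defs.
From mathcomp Require Import all_boot all_order all_algebra.
From mathcomp Require Import boolp reals exp zify ring lra.

Set Implicit Arguments.
Unset Strict Implicit.
Unset Printing Implicit Defensive.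

Import Order.TTheory GRing.Theory Num.Theory.

(** * Simple families and partial rainbow matchings *)

Definition simple_family (T I : finType) (F : I -> {set {set T}}) :=
  (forall i, matching (F i)) /\
  (forall i j a, a \in F i -> a \in F j -> i = j).

(* A partial rainbow matching is a set C of colours with an edge e i for each
   i in C; the values of e outside C are irrelevant. *)
Definition rainbow (T I : finType) (F : I -> {set {set T}})
    (C : {set I}) (e : I -> {set T}) :=
  (forall i, i \in C -> e i \in F i) /\
  (forall i j v, i \in C -> j \in C -> v \in e i -> v \in e j -> i = j).

Lemma card_bigcup_le (T I : finType) (J : {set I}) (e : I -> {set T}) k :
  (forall i, i \in J -> #|e i| <= k) -> #|\bigcup_(i in J) e i| <= k * #|J|.
Proof.
move=> ek; rewrite mulnC -sum_nat_const.
apply: (@leq_trans (\sum_(i in J) #|e i|)); last exact: leq_sum.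
elim/big_rec2: _ => [|j n A _ leA]; first by rewrite cards0.
by apply: leq_trans (leq_card_setU _ _) _; rewrite leq_add2l.
Qed.

Lemma sum_set2 (T : finType) (x y : T) (h : T -> nat) :
  x != y -> \sum_(v in [set x; y]) h v = h x + h y.
Proof. by move=> xy; rewrite big_setU1 ?big_set1 ?inE. Qed.

Section SimpleFamily.
Variables (T I : finType) (F : I -> {set {set T}}).
Hypothesis simF : simple_family F.

Lemma edge_card i a : a \in F i -> #|a| = 2.
Proof. by move=> aF; have /andP[/forall_inP/(_ a aF)/eqP] := simF.1 i. Qed.

Lemma edge_color i j a : a \in F i -> a \in F j -> i = j.
Proof. exact: simF.2. Qed.

Lemma edge_trivIset i : trivIset (F i).
Proof. by have /andP[] := simF.1 i. Qed.

End SimpleFamily.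

(** * The augmenting argument: exchanges and releasable vertices *)

Section Augment.
Variables (T I : finType) (F : I -> {set {set T}}).
Hypothesis simF : simple_family F.
Variables (Q C : {set I}) (e : I -> {set T}) (B t D : nat).
Hypothesis CQ : C \subset Q.
Hypothesis rbe : rainbow F C e.
Hypothesis noaug :
  forall (C' : {set I}) (e' : I -> {set T}),
    C' \subset Q -> rainbow F C' e' -> #|C'| <> #|C|.+1.
Hypothesis tB : 3 * B < t.

(* A partial exchange: the matching e on C gives up the colours C \ C' and gains
   the edges of colours C' \ C, which may still clash with old edges, but only at
   vertices of Z. *)
Definition semi_rainbow (Z : {set T}) (C' : {set I}) (e' : I -> {set T}) :=
  [/\ C' \subset Q, forall i, i \in C' -> e' i \in F i,
      forall i, i \in C -> e' i = e i,
      forall i j v, i \in C' :\: C -> j \in C' :\: C ->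
        v \in e' i -> v \in e' j -> i = j
    & forall i j v, i \in C' -> i \in C -> j \in C' :\: C ->
        v \in e i -> v \in e' j -> v \in Z].

(* The clash at a vertex w of W can be removed by at most k further exchanges; B
   bounds the total number of exchanges. *)
Definition releasable k (W : {set T}) :=
  forall (C' : {set I}) (e' : I -> {set T}) (Z : {set T}) w,
    semi_rainbow (w |: Z) C' e' -> w \in W ->
    (forall i x y, i \in C -> y \in e i -> y \in W ->
       x \in e i -> x \in Z -> x = y) ->
    #|C' :\: C| + k <= B ->
  exists (C'' : {set I}) e'', [/\ semi_rainbow Z C'' e'', #|C''| = #|C'|
                    & #|C'' :\: C| <= #|C' :\: C| + k].

Definition independent (W : {set T}) :=
  forall i x y, i \in C -> x \in e i -> y \in e i ->
    x \in W -> y \in W -> x = y.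

Definition access (W : {set T}) x :=
  [set j in Q :\: C | [exists w in W, [set w; x] \in F j]].

Lemma accessP (W : {set T}) x j :
  reflect ([/\ j \in Q, j \notin C & exists2 w, w \in W & [set w; x] \in F j])
          (j \in access W x).
Proof.
rewrite !inE; apply: (iffP andP) => [[/andP[jC jQ] /exists_inP]|[jQ jC ex]] //.
by split; [rewrite jC jQ | apply/exists_inP].
Qed.

(** Both ends of the edge are kept outside [W]: a partner of a vertex of [W] is never added, so
    independence can survive. *)
Definition extension (W : {set T}) :=
  [set y | y \notin W & [exists i in C, exists x,
     [&& x \notin W, x != y, e i == [set x; y] & t <= #|access W x|]]].

Lemma extensionP (W : {set T}) y :
  reflect (y \notin W /\ exists i x, [/\ i \in C, x \notin W, x != y,
             e i = [set x; y] & t <= #|access W x|])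
          (y \in extension W).
Proof.
rewrite inE; apply: (iffP andP) => [[yW /exists_inP[i iC /existsP[x]]]|].
  by case/and4P=> xW xy /eqP ei tx; split=> //; exists i, x.
case=> yW [i [x [iC xW xy ei tx]]]; split=> //.
by apply/exists_inP; exists i => //; apply/existsP; exists x; apply/and4P; split=> //; apply/eqP.
Qed.

(** A vertex spans with [x] at most one edge, and that edge has only one colour, so forbidding the
    vertices of [S] excludes at most [#|S|] colours. *)
Lemma access_avoid (W : {set T}) x (J : {set I}) (S : {set T}) :
  #|J| + #|S| < #|access W x| ->
  exists j w, [/\ [/\ j \in Q, j \notin C & j \notin J], w \in W, w \notin S
                & [set w; x] \in F j].
Proof.
move=> lt.
pose K := [set j | [exists w in S, [set w; x] \in F j]].
have cK : #|K| <= #|S|.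
  (* On [K] a blocking vertex exists, so the default [x] is never taken there. *)
  pose g j := odflt x [pick w in S | [set w; x] \in F j].
  have gP j : j \in K -> g j \in S /\ [set g j; x] \in F j.
    rewrite inE /g => /exists_inP[w wS wF]; case: pickP => [w' /andP[]//|].
    by move/(_ w); rewrite wS wF.
  have injg : {in K &, injective g}.
    move=> i j /gP[_ Fi] /gP[_ Fj] eq; rewrite eq in Fi.
    exact: (edge_color simF Fi Fj).
  rewrite -(card_in_imset injg); apply: subset_leq_card.
  by apply/subsetP=> _ /imsetP[j /gP[gS _] ->].
have /subsetPn[j jA] : ~~ (access W x \subset J :|: K).
  apply: contraTN lt => /subset_leq_card le; rewrite -leqNgt.
  apply: leq_trans le _; apply: leq_trans (leq_card_setU _ _) _.
  by rewrite leq_add2l.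
rewrite inE negb_or => /andP[jJ jK].
have [jQ jC [w wW wF]] := accessP _ _ _ jA.
exists j, w; split=> //; apply: contra jK => wS.
by rewrite inE; apply/exists_inP; exists w.
Qed.

(** Releasing [w] and then [w'] leaves a rainbow matching with one edge more, against [noaug].
    Independence gives the side condition of the first release, during which a clash at [w'] is
    still tolerated. *)
Lemma augment_pair k (W : {set T}) C' e' w w' :
  independent W -> releasable k W ->
  semi_rainbow (w |: [set w']) C' e' -> w \in W -> w' \in W ->
  #|C'| = #|C|.+1 -> #|C' :\: C| + k + k <= B -> False.
Proof.
move=> ind rel st wW w'W cC' le.
have [C1 [e1 [st1 cC1 le1]]] : exists (C'' : {set I}) e'', [/\ semi_rainbow [set w'] C'' e'',
    #|C''| = #|C'| & #|C'' :\: C| <= #|C' :\: C| + k].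
  apply: rel st wW _ _; last by lia.
  by move=> i x y iC ye yW xe /set1P xw; apply: (ind i) => //; rewrite xw.
have [C2 [e2 [st2 cC2 le2]]] : exists (C'' : {set I}) e'', [/\ semi_rainbow set0 C'' e'',
    #|C''| = #|C1| & #|C'' :\: C| <= #|C1 :\: C| + k].
  apply: (rel C1 e1 _ w'); rewrite ?setU0 //; last by lia.
  by move=> i x y _ _ _ _; rewrite inE.
have [sub eF eC d1 d2] := st2.
apply: (noaug sub (e' := e2)); last by rewrite cC2 cC1.
split=> // i j v iC2 jC2 vi vj.
case iC: (i \in C); case jC: (j \in C).
- by rewrite (eC i iC) in vi; rewrite (eC j jC) in vj; apply: rbe.2 vi vj.
- rewrite (eC i iC) in vi; have := d2 i j v iC2 iC; rewrite !inE jC jC2.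
  by move=> /(_ isT vi vj).
- rewrite (eC j jC) in vj; have := d2 j i v jC2 jC; rewrite !inE iC iC2.
  by move=> /(_ isT vj vi).
by apply: d1 vi vj; rewrite inE ?iC ?jC.
Qed.

(** Adding the edge clashes only at its ends, which can both be released; the budget is one new edge
    and two releases. *)
Lemma no_inner_edge k (W : {set T}) j w w' :
  independent W -> releasable k W -> 1 + k + k <= B ->
  j \in Q :\: C -> w \in W -> w' \in W -> [set w; w'] \in F j -> False.
Proof.
move=> ind rel le; rewrite inE => /andP[jC jQ] wW w'W wF.
pose e' i := if i == j then [set w; w'] else e i.
have jNC i : i \in C -> (i == j) = false by move=> iC; apply: contraNF jC => /eqP <-.
have dC : (j |: C) :\: C = [set j].
  apply/setP=> i; rewrite !inE; case: eqP => [->|_]; first by rewrite jC.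
  by case: (i \in C).
apply: (@augment_pair k W (j |: C) e' w w' ind rel) => //; last first.
- by rewrite dC cards1.
- by rewrite cardsU1 jC.
split.
- by rewrite subUset sub1set jQ.
- move=> i; rewrite !inE /e'; case: eqP => [-> //|_ /=]; exact: rbe.1.
- by move=> i iC; rewrite /e' jNC.
- by rewrite dC => i i' v /set1P-> /set1P->.
move=> i i' v _ iC; rewrite dC => /set1P-> _; by rewrite /e' eqxx.
Qed.

(** Exchanging the edge of colour [i] for edges [wx] and [w'y] of two missing colours gains one
    colour and clashes only at [w] and [w']. The second choice must avoid the colour and the vertex
    of the first, hence the bound 2. *)
Lemma no_two_sided k (W : {set T}) i x y :
  independent W -> releasable k W -> 2 + k + k <= B ->
  i \in C -> e i = [set x; y] -> x \notin W -> y \notin W -> x != y ->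
  0 < #|access W x| -> 2 < #|access W y| -> False.
Proof.
move=> ind rel le iC ei xW yW xy cx cy.
have [j [w [[jQ jC _] wW _ wF]]] : exists j w, [/\ [/\ j \in Q, j \notin C
   & j \notin set0], w \in W, w \notin set0 & [set w; x] \in F j].
  by apply: access_avoid; rewrite !cards0.
have [j' [w' [[j'Q j'C]]]] : exists j' w', [/\ [/\ j' \in Q, j' \notin C
   & j' \notin [set j]], w' \in W, w' \notin [set w] & [set w'; y] \in F j'].
  by apply: access_avoid; rewrite !cards1.
rewrite !inE => j'j w'W w'w w'F.
pose e' l := if l == j then [set w; x] else if l == j' then [set w'; y] else e l.
pose C' := j |: (j' |: C :\ i).
have jNC l : l \in C -> (l == j) = false by move=> lC; apply: contraNF jC => /eqP <-.
have j'NC l : l \in C -> (l == j') = false by move=> lC; apply: contraNF j'C => /eqP <-.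
have dC : C' :\: C = [set j; j'].
  apply/setP=> l; rewrite !inE; case lC: (l \in C); first by rewrite jNC ?j'NC.
  by rewrite andbF orbF.
have ej : e' j = [set w; x] by rewrite /e' eqxx.
have ej' : e' j' = [set w'; y] by rewrite /e' (negPf j'j) eqxx.
have disj v : v \in [set w; x] -> v \in [set w'; y] -> False.
  move/set2P=> [] -> /set2P[] E.
  - by rewrite E eqxx in w'w.
  - by rewrite -E wW in yW.
  - by rewrite E w'W in xW.
  - by rewrite E eqxx in xy.
apply: (@augment_pair k W C' e' w w' ind rel) => //; last first.
- by rewrite dC cards2 eq_sym j'j.
- rewrite /C' !cardsU1 (cardsD1 i C) iC !inE (negPf jC) (negPf j'C) eq_sym (negPf j'j) !andbF.
  by rewrite !add1n.
split.
- rewrite !subUset !sub1set jQ j'Q /=; exact: subset_trans (subsetDl _ _) CQ.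
- move=> l; rewrite !inE /e'; case: eqP => [-> //|_ /=]; case: eqP => [-> //|_ /=].
  by case/andP=> _; apply: rbe.1.
- by move=> l lC; rewrite /e' jNC ?j'NC.
- rewrite dC => l l' v /set2P[]-> /set2P[]-> //; rewrite ej ej' => v1 v2.
    by case: (disj v).
  by case: (disj v).
move=> l l' v lC' lC.
have li : l != i by move: lC'; rewrite !inE jNC ?j'NC //= => /andP[].
rewrite dC => /set2P[]-> vl; rewrite ?ej ?ej' => /set2P[] E.
- by rewrite E !inE eqxx.
- case/eqP: li; apply: (rbe.2 l i v) => //; by rewrite ei E !inE eqxx.
- by rewrite E !inE eqxx orbT.
- case/eqP: li; apply: (rbe.2 l i v) => //; by rewrite ei E !inE eqxx orbT.
Qed.

(** Two ends of one matching edge in the extension would both have at least [t] accessible colours,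
    which [no_two_sided] excludes. *)
Lemma independent_extension k (W : {set T}) :
  independent W -> releasable k W -> 2 + k + k <= B ->
  independent (W :|: extension W).
Proof.
move=> ind rel le i x y iC xe ye.
have t2 : 2 < t by lia.
have other u v : u \in e i -> v \in e i -> u \in extension W -> u != v ->
   [/\ v \notin W, u \notin W, e i = [set v; u] & t <= #|access W v|].
  move=> ue ve /extensionP[uW [i' [x' [i'C x'W x'u ei' tx']]]] uv.
  have ii' : i' = i by apply: (rbe.2 i' i u) => //; rewrite ei' !inE eqxx orbT.
  rewrite ii' in ei'; move: ve; rewrite ei' => /set2P[E|E]; last by rewrite E eqxx in uv.
  by rewrite E.
move=> /setUP[xW|xE] /setUP[yW|yE]; apply/eqP; apply: contraT => xy.
- by case/eqP: xy; apply: (ind i).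
- by rewrite eq_sym in xy; case: (other y x ye xe yE xy); rewrite xW.
- by case: (other x y xe ye xE xy); rewrite yW.
exfalso.
have [yW xW ei ty] := other x y xe ye xE xy.
have [_ _ _ tx] := other y x ye xe yE (etrans (congr1 negb (eq_sym y x)) xy).
apply: (no_two_sided ind rel le iC ei yW xW); rewrite 1?eq_sym //; lia.
Qed.

(** If [w] is new, with partner [x], its edge is exchanged for an edge [ux] of a fresh colour with
    [u] in [W]. The clash moves from [w] to [u], which can be released; this costs one more
    exchange. *)
Lemma releasable_extension k (W : {set T}) :
  releasable k W -> releasable k.+1 (W :|: extension W).
Proof.
move=> rel C' e' Z w st wW' compat le.
have compatW i x y : i \in C -> y \in e i -> y \in W ->
       x \in e i -> x \in Z -> x = y.
  by move=> iC ye yW; apply: (compat i) => //; rewrite inE yW.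
case wW: (w \in W).
  have [|C'' [e'' [st2 c2 le2]]] := rel C' e' Z w st wW compatW; first by lia.
  by exists C'', e''; split=> //; lia.
move: (wW'); rewrite inE wW /= => /extensionP[_ [i [x [iC xW xw ei tx]]]].
have [sub eF eC d1 d2] := st.
have uniqi l v : l \in C -> v \in e l -> v \in e i -> l = i.
  by move=> lC vl vi; apply: (rbe.2 l i v).
(* If colour [i] was already given up, no old edge is left at [w] and the clash is void. *)
case iC': (i \in C'); last first.
  exists C', e'; split=> //; last by lia.
  split=> // l l' v lC' lC l'C' vl vl'.
  have := d2 l l' v lC' lC l'C' vl vl'; rewrite !inE => /orP[/eqP vw|//].
  have li : l = i by apply: (uniqi l v) => //; rewrite vw ei !inE eqxx orbT.
  by rewrite li iC' in lC'.
(* The gained edges forbid their own colours and their ends, at most [3 * B < t] objects in all. *)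
pose S := \bigcup_(j in C' :\: C) e' j.
have cS : #|S| <= 2 * #|C' :\: C|.
  apply: card_bigcup_le => j; rewrite inE => /andP[_ jC'].
  by rewrite (edge_card simF (eF j jC')).
have [j [u [[jQ jC jJ] uW uS uF]]] : exists j u, [/\ [/\ j \in Q, j \notin C
   & j \notin C' :\: C], u \in W, u \notin S & [set u; x] \in F j].
  by apply: access_avoid; lia.
have jC' : j \notin C' by move: jJ; rewrite inE jC.
pose e2 l := if l == j then [set u; x] else e' l.
pose C2 := j |: C' :\ i.
have jNC l : l \in C -> (l == j) = false by move=> lC; apply: contraNF jC => /eqP <-.
have e2j : e2 j = [set u; x] by rewrite /e2 eqxx.
have dC : C2 :\: C = j |: C' :\: C.
  apply/setP=> l; rewrite !inE; case lC: (l \in C); first by rewrite jNC.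
  by case: (l =P i) => [li|//]; rewrite li iC in lC.
have e2N l : l \in C' -> e2 l = e' l.
  by move=> lC'; rewrite /e2; case: eqP => // lj; rewrite lj (negPf jC') in lC'.
have xi : x \in e i by rewrite ei !inE eqxx.
have wi : w \in e i by rewrite ei !inE eqxx orbT.
(* A gained edge at [x] would clash there with the old edge [xw], forcing [x] into [Z]; [compat]
   forbids this for the partner of [w]. *)
have xS l : l \in C' :\: C -> x \in e' l -> False.
  move=> lC xl; have := d2 i l x iC' iC lC xi xl.
  rewrite !inE (negPf xw) /= => xZ.
  by case/eqP: xw; apply: (compat i x w).
have uS' l : l \in C' :\: C -> u \in e' l -> False.
  by move=> lC ul; case/negP: uS; apply/bigcupP; exists l.
have ux v l : l \in C' :\: C -> v \in e' l -> v \in [set u; x] -> False.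
  by move=> lC vl /set2P[] E; rewrite E in vl; [apply: (uS' l)|apply: (xS l)].
have st2 : semi_rainbow (u |: Z) C2 e2.
  split.
  - rewrite subUset sub1set jQ /=; exact: subset_trans (subsetDl _ _) sub.
  - move=> l; rewrite !inE => /orP[/eqP->|/andP[_ lC']]; first by rewrite e2j.
    by rewrite e2N //; apply: eF.
  - by move=> l lC; rewrite /e2 jNC // eC.
  - rewrite dC => l l' v /setU1P[->|lC] /setU1P[->|l'C] //.
    + rewrite e2j e2N; last by move: l'C; rewrite inE => /andP[].
      by move=> v1 v2; case: (ux v l').
    + rewrite e2j e2N; last by move: lC; rewrite inE => /andP[].
      by move=> v1 v2; case: (ux v l).
    rewrite !e2N; first exact: d1.
      by move: l'C; rewrite inE => /andP[].
    by move: lC; rewrite inE => /andP[].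
  move=> l l' v lC2 lC; rewrite dC; move: lC2; rewrite !inE jNC //= => /andP[li lC'].
  rewrite -in_setD -in_setU1 => /setU1P[->|l'C] vl.
    rewrite e2j => /set2P[->|vx]; first by rewrite eqxx.
    by case/eqP: li; apply: (uniqi l v) => //; rewrite vx.
  rewrite e2N => [vl'|]; last by move: l'C; rewrite inE => /andP[].
  have := d2 l l' v lC' lC l'C vl vl'; rewrite !inE => /orP[/eqP vw|->]; last by rewrite orbT.
  by case/eqP: li; apply: (uniqi l v) => //; rewrite vw.
have c2 : #|C2| = #|C'|.
  by rewrite /C2 cardsU1 !inE (negPf jC') andbF (cardsD1 i C') iC'.
have c2C : #|C2 :\: C| = (#|C' :\: C|).+1 by rewrite dC cardsU1 jJ.
have [|C3 [e3 [st3 c3 le3]]] := rel C2 e2 Z u st2 uW compatW.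
  by rewrite c2C addSnnS.
by exists C3, e3; rewrite c3 c2 -addSnnS -c2C.
Qed.

Definition touched (W : {set T}) := [set i in C | [exists x in e i, x \in W]].

Lemma touchedP (W : {set T}) i :
  reflect (i \in C /\ exists2 x, x \in e i & x \in W) (i \in touched W).
Proof.
by rewrite inE; apply: (iffP andP) => -[iC /exists_inP].
Qed.

Lemma rainbow_edge2 i : i \in C -> exists x y, x != y /\ e i = [set x; y].
Proof. by move/rbe.1/(edge_card simF)/eqP/cards2P. Qed.

Lemma sum_covered (h : T -> nat) :
  (forall v, 0 < h v -> exists2 i, i \in C & v \in e i) ->
  \sum_v h v <= \sum_(i in C) \sum_(v in e i) h v.
Proof.
move=> hC; rewrite (exchange_big_dep xpredT) //=; apply: leq_sum => v _.
case: (posnP (h v)) => [->//|/hC[i iC vi]].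
by rewrite (bigD1 i) ?iC //= leq_addr.
Qed.

(** Double counting: the weights bound the edges of a missing colour, so each such colour reaches at
    least [4 * D] vertices of [Fr] from [W]. Vertices reached in fewer than [t] colours account for
    at most half of this in total; the others lie on at least [D] untouched edges, and their
    partners enter the extension. *)
Lemma touched_extension k (W : {set T}) :
  independent W -> releasable k W -> 2 + k + k <= B ->
  (forall v, v \notin W -> exists2 i, i \in C & v \in e i) ->
  C \proper Q -> t * #|Q| <= #|Q :\: C| * D ->
  (forall j, j \in Q -> #|Q| + 2 * D <= #|F j|) ->
  #|touched W| + D <= #|touched (W :|: extension W)|.
Proof.
move=> ind rel le cov pCQ tQ FQ.
pose Fr := \bigcup_(i in C :\: touched W) e i.
have FrW v : v \in Fr -> v \notin W.
  move=> vFr; have /bigcupP[i] := vFr; rewrite inE => /andP[it iC] vi.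
  by apply: contra it => vW; apply/touchedP; split=> //; exists v.
(* Weight 0 on W, 1 on matching edges that avoid W and 2 on the partners of
   vertices of W: every matching edge has total weight at most 2, and an edge of
   a missing colour has weight at least 2 unless it joins W to a vertex of Fr. *)
pose h v := if v \in W then 0 else if v \in Fr then 1 else 2.
have h0 v : v \in W -> h v = 0 by rewrite /h => ->.
have h1 v : v \in Fr -> h v = 1.
  by move=> vF; rewrite /h vF (negPf (FrW v vF)).
have h2 v : h v <= 2 by rewrite /h; case: ifP => // _; case: ifP.
have sumh : \sum_v h v <= 2 * #|C|.
  apply: leq_trans (sum_covered _) _.
    by move=> v; rewrite /h; case vW: (v \in W) => // _; apply: cov; rewrite vW.
  rewrite mulnC -sum_nat_const; apply: leq_sum => i iC.
  have [x [y [xy ei]]] := rainbow_edge2 iC.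
  case it: (i \in touched W); last first.
    have iFr v : v \in e i -> v \in Fr.
      by move=> vi; apply/bigcupP; exists i; rewrite // inE it.
    by rewrite ei sum_set2 // !h1 //; apply: iFr; rewrite ei !inE eqxx ?orbT.
  have /touchedP[_ [v]] := it; rewrite ei sum_set2 // => /set2P[]-> vW.
    by rewrite (h0 x vW) h2.
  by rewrite (h0 y vW) addn0 h2.
(* The added unit pays for the edges from [W] to [Fr], whose weight under [h] is only 1. *)
pose g j v := h v + ((v \in Fr) && (j \in access W v)).
have gF j a : j \in Q :\: C -> a \in F j -> 2 <= \sum_(v in a) g j v.
  move=> jQC aF; have /eqP/cards2P[x [y [xy ea]]] := edge_card simF aF.
  rewrite ea sum_set2 //; rewrite {}ea in aF.
  have half u v : [set u; v] \in F j -> u \in W -> v \notin W -> 2 <= g j v.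
    move=> uvF uW vW; rewrite /g.
    have -> : j \in access W v.
      move: jQC; rewrite inE => /andP[jC jQ].
      by apply/accessP; split=> //; exists u.
    by rewrite /h (negPf vW) andbT; case: (v \in Fr).
  have pos v : v \notin W -> 0 < g j v.
    by move=> vW; rewrite /g /h (negPf vW); case: (v \in Fr).
  case xW: (x \in W); case yW: (y \in W).
  - by case: (no_inner_edge ind rel _ jQC xW yW aF); lia.
  - by apply: leq_trans (leq_addl _ _); apply: (half x); rewrite ?yW.
  - by apply: leq_trans (leq_addr _ _); apply: (half y); rewrite 1?setUC ?xW.
  by rewrite -[2]/(1 + 1); apply: leq_add; apply: pos; rewrite ?xW ?yW.
have sumg j : j \in Q :\: C ->
    2 * (#|Q| + 2 * D) <= 2 * #|C| + \sum_v ((v \in Fr) && (j \in access W v)).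
  move=> jQC; have jQ : j \in Q by move: jQC; rewrite inE => /andP[].
  apply: leq_trans (_ : \sum_v g j v <= _); last by rewrite big_split leq_add2r.
  apply: leq_trans (_ : \sum_(v in cover (F j)) g j v <= _); last first.
    by rewrite [leqRHS](bigID (mem (cover (F j)))) /= leq_addr.
  rewrite big_trivIset ?(edge_trivIset simF) //=.
  apply: leq_trans (_ : \sum_(a in F j) 2 <= _).
    by rewrite sum_nat_const mulnC leq_mul2r FQ ?orbT.
  by apply: leq_sum => a aF; apply: gF.
pose A := [set i in C :\: touched W | [exists x in e i, t <= #|access W x|]].
have cFr : #|Fr| <= 2 * #|C|.
  apply: leq_trans (card_bigcup_le (k := 2) _) _.
    by move=> i; rewrite inE => /andP[_ iC]; rewrite (edge_card simF (rbe.1 i iC)).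
  by rewrite leq_mul2l subset_leq_card ?subsetDl.
have cA : #|[set v in Fr | t <= #|access W v|]| <= 2 * #|A|.
  apply: leq_trans (card_bigcup_le (e := e) (k := 2) _); last first.
    by move=> i; rewrite !inE => /andP[/andP[_ iC] _]; rewrite (edge_card simF (rbe.1 i iC)).
  apply: subset_leq_card; apply/subsetP=> v; rewrite inE => /andP[/bigcupP[i iCt vi] tv].
  by apply/bigcupP; exists i; rewrite // inE iCt; apply/exists_inP; exists v.
set s := #|Q :\: C| in tQ *.
have s0 : 0 < s.
  rewrite /s card_gt0; apply: contraTneq pCQ => /eqP; rewrite setD_eq0 => QC.
  by rewrite properE QC andbF.
have accs v : #|access W v| <= t + s * (t <= #|access W v|).
  case: (leqP t #|access W v|) => [_|/ltnW le'] /=; last by rewrite muln0 addn0.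
  rewrite muln1; apply: leq_trans (leq_addl _ _); apply: subset_leq_card.
  by apply/subsetP=> j; rewrite inE => /andP[].
have sumacc : \sum_(v in Fr) #|access W v| <= t * (2 * #|C|) + s * (2 * #|A|).
  apply: (@leq_trans (\sum_(v in Fr) (t + s * (t <= #|access W v|)))).
    by apply: leq_sum => v _; apply: accs.
  rewrite big_split /= sum_nat_const mulnC; apply: leq_add.
    by rewrite leq_mul2l cFr orbT.
  rewrite -big_distrr /= leq_mul2l; apply/orP; right; apply: leq_trans cA.
  rewrite -sum1dep_card [leqRHS]big_mkcondr /=.
  by apply: leq_sum => v _; case: (t <= #|access W v|).
have total : s * (2 * (#|Q| + 2 * D)) <=
    s * (2 * #|C|) + (t * (2 * #|C|) + s * (2 * #|A|)).
  apply: leq_trans (_ : \sum_(j in Q :\: C)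
    (2 * #|C| + \sum_v ((v \in Fr) && (j \in access W v))) <= _).
    by rewrite -sum_nat_const; apply: leq_sum => j; apply: sumg.
  rewrite big_split /= sum_nat_const leq_add2l; apply: leq_trans sumacc.
  rewrite exchange_big /= [leqRHS]big_mkcond /=; apply: leq_sum => v _.
  case: (v \in Fr) => /=; last by rewrite big1.
  rewrite -sum1_card [leqRHS]big_mkcond [leqLHS]big_mkcond /=; apply: leq_sum => j _.
  by case: (_ \in _) => //; case: (_ \in _).
have DA : D <= #|A|.
  have cCQ : #|C| <= #|Q| by apply: subset_leq_card.
  have tC : t * #|C| <= s * D by apply: leq_trans tQ; rewrite leq_mul2l cCQ orbT.
  have sC : s * #|C| <= s * #|Q| by rewrite leq_mul2l cCQ orbT.
  rewrite -(leq_pmul2l s0); move: total tC sC; clearbody s; clear.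
  by move: #|A| #|Q| #|C| => a q c; lia.
apply: leq_trans (_ : #|touched W :|: A| <= _).
  rewrite cardsU; have -> : touched W :&: A = set0.
    apply/setP=> i; rewrite in_setI !(in_set, in_setD).
    by case: (i \in C); rewrite ?andbF //= andbT andbA andbN.
  by rewrite cards0 subn0 leq_add2l.
apply: subset_leq_card; apply/subsetP=> i /setUP[/touchedP[iC [x xi xW]]|].
  by apply/touchedP; split=> //; exists x; rewrite // inE xW.
rewrite inE => /andP[]; rewrite inE => /andP[it iC] /exists_inP[x xi tx].
have nW v : v \in e i -> v \notin W.
  by move=> vi; apply: contra it => vW; apply/touchedP; split=> //; exists v.
have [y yi [xy ei]] : exists2 y, y \in e i & x != y /\ e i = [set x; y].
  have [u [v [uv ei]]] := rainbow_edge2 iC.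
  move: xi; rewrite ei => /set2P[]->.
    by exists v; rewrite // !inE eqxx orbT.
  by exists u; [rewrite !inE eqxx | rewrite eq_sym setUC].
apply/touchedP; split=> //; exists y => //; apply/setUP; right.
by apply/extensionP; split; [apply: nW | exists i, x; split=> //; apply: nW].
Qed.

(** The start is the set of uncovered vertices, where no old edge can clash. The bound [2 * k <= B]
    leaves room for two new edges and two releases at every stage. *)
Lemma extension_chain k : 2 * k <= B -> C \proper Q ->
  t * #|Q| <= #|Q :\: C| * D ->
  (forall j, j \in Q -> #|Q| + 2 * D <= #|F j|) ->
  exists W : {set T}, [/\ independent W, releasable k W,
    forall v, v \notin W -> exists2 i, i \in C & v \in e i
    & k * D <= #|touched W|].
Proof.
move=> kB pCQ tQ FQ; elim: k kB => [_|k IH kB].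
  pose U := ~: \bigcup_(i in C) e i.
  have UP i v : i \in C -> v \in e i -> v \in U -> False.
    by move=> iC vi; rewrite inE => /bigcupP; case; exists i.
  exists U; split=> //.
  - by move=> i x y iC xi _ xU; case: (UP i x).
  - move=> C' e' Z w [sub eF eC d1 d2] wU _ _; exists C', e'; split; rewrite ?addn0 //.
    split=> // i j v iC' iC jC vi vj.
    have := d2 i j v iC' iC jC vi vj; rewrite !inE => /orP[/eqP vw|//].
    by case: (UP i v); rewrite // vw.
  by move=> v; rewrite inE negbK => /bigcupP[i iC vi]; exists i.
have [|W [ind rel cov cW]] := IH; first by lia.
have le : 2 + k + k <= B by lia.
exists (W :|: extension W); split.
- exact: independent_extension ind rel le.
- exact: releasable_extension rel.
- by move=> v; rewrite inE negb_or => /andP[vW _]; apply: cov.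
apply: leq_trans (touched_extension ind rel le cov pCQ tQ FQ).
by rewrite mulSn addnC leq_add2r.
Qed.

End Augment.

(** * Near-full rainbow matchings *)

(** Without an augmentation, [K] extensions would touch [K * D > #|Q|] edges of a matching with at
    most [#|Q|] edges. The budget is [B = 2 * K], and [t = 6 * K + 1] just exceeds [3 * B]. *)
Lemma rainbow_augment (T I : finType) (F : I -> {set {set T}})
    (Q C : {set I}) (e : I -> {set T}) K D s :
  simple_family F -> C \subset Q -> rainbow F C e ->
  #|Q| < K * D -> (6 * K).+1 * #|Q| <= s * D -> s <= #|Q :\: C| -> 0 < s ->
  (forall j, j \in Q -> #|Q| + 2 * D <= #|F j|) ->
  exists (C' : {set I}) e', [/\ C' \subset Q, rainbow F C' e' & #|C'| = #|C|.+1].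
Proof.
move=> simF CQ rbe QK tQ sQC s0 FQ; apply: contrapT => no.
have noaug (C' : {set I}) (e' : I -> {set T}) :
    C' \subset Q -> rainbow F C' e' -> #|C'| <> #|C|.+1.
  by move=> sub rb eq; apply: no; exists C', e'.
have pCQ : C \proper Q.
  rewrite properE CQ -setD_eq0; apply: contraL s0 => /eqP QC.
  by move: sQC; rewrite QC cards0 leqn0 => /eqP->.
have tB : 3 * (2 * K) < (6 * K).+1 by rewrite mulnA.
have tQ' : (6 * K).+1 * #|Q| <= #|Q :\: C| * D.
  by apply: leq_trans tQ _; rewrite leq_mul2r sQC orbT.
have [W [_ _ _]] := extension_chain simF CQ rbe noaug tB (leqnn _) pCQ tQ' FQ.
apply/negP; rewrite -ltnNge; apply: leq_ltn_trans QK.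
apply: leq_trans (subset_leq_card CQ); apply: subset_leq_card.
by apply/subsetP=> i; rewrite inE => /andP[].
Qed.

(** If every rainbow matching missed at least [s] colours, repeated augmentation would exceed size
    [#|Q|]. *)
Lemma near_full_rainbow (T I : finType) (F : I -> {set {set T}})
    (Q : {set I}) K D s :
  simple_family F -> #|Q| < K * D -> (6 * K).+1 * #|Q| <= s * D -> 0 < s ->
  (forall j, j \in Q -> #|Q| + 2 * D <= #|F j|) ->
  exists (C : {set I}) e, [/\ C \subset Q, rainbow F C e & #|Q :\: C| < s].
Proof.
move=> simF QK tQ s0 FQ; apply: contrapT => no.
suff /(_ #|Q|.+1)[C [e [CQ _ cC]]] : forall c,
    exists (C : {set I}) e, [/\ C \subset Q, rainbow F C e & #|C| = c].
  by have := subset_leq_card CQ; rewrite cC ltnn.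
elim=> [|c [C [e [CQ rb cC]]]].
  exists set0, (fun=> set0); split; rewrite ?sub0set ?cards0 //.
  by split=> [i|i j v]; rewrite inE.
have sQC : s <= #|Q :\: C|.
  by rewrite leqNgt; apply/negP => lt; apply: no; exists C, e.
by rewrite -cC; apply: rainbow_augment simF CQ rb QK tQ sQC s0 FQ.
Qed.

(** * Restriction to vertex sets, greedy choice and assembly *)

Definition restrict (T I : finType) (F : I -> {set {set T}}) (R : {set T}) :=
  fun i => [set a in F i | a \subset R].

Section Restrict.
Variables (T I : finType) (F : I -> {set {set T}}).

Lemma restrict_simple R : simple_family F -> simple_family (restrict F R).
Proof.
move=> simF; split=> [i|i j a]; last first.
  by rewrite !inE => /andP[ai _] /andP[aj _]; apply: (edge_color simF ai aj).
have sub : restrict F R i \subset F i by apply/subsetP=> a; rewrite inE => /andP[].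
have /andP[/forall_inP e2 tr] := simF.1 i.
rewrite /matching (trivIsetS sub tr) andbT; apply/forall_inP=> a /(subsetP sub).
exact: e2.
Qed.

Lemma rainbow_restrictW R (C : {set I}) e :
  rainbow (restrict F R) C e -> rainbow F C e.
Proof. by case=> eF inj; split=> // i /eF; rewrite inE => /andP[]. Qed.

Lemma rainbow_join (R1 R2 : {set T}) (C1 C2 : {set I}) (e1 e2 : I -> {set T}) :
  [disjoint R1 & R2] ->
  rainbow (restrict F R1) C1 e1 -> rainbow (restrict F R2) C2 e2 ->
  exists e, rainbow (restrict F (R1 :|: R2)) (C1 :|: C2) e.
Proof.
rewrite disjoint_subset => /subsetP dR [eF1 inj1] [eF2 inj2].
have sub1 i v : i \in C1 -> v \in e1 i -> v \in R1.
  by move=> /eF1; rewrite inE => /andP[_ /subsetP]; apply.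
have sub2 i v : i \in C2 -> v \in e2 i -> v \in R2.
  by move=> /eF2; rewrite inE => /andP[_ /subsetP]; apply.
have no12 i j v : i \in C1 -> j \in C2 -> v \in e1 i -> v \in e2 j -> False.
  by move=> iC jC /(sub1 _ _ iC)/dR; rewrite inE => /negP vR /(sub2 _ _ jC)/vR.
exists (fun i => if i \in C1 then e1 i else e2 i); split=> [i|i j v].
  rewrite inE; case: ifP => [iC _|_ /= iC].
    have := eF1 i iC; rewrite !inE => /andP[-> /subset_trans]; apply.
    exact: subsetUl.
  have := eF2 i iC; rewrite !inE => /andP[-> /subset_trans]; apply.
  exact: subsetUr.
rewrite !inE; case: ifP => [iC _|_ /= iC]; case: ifP => [jC _|_ /= jC].
- exact: inj1.
- by move=> vi vj; case: (no12 i j v).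
- by move=> vi vj; case: (no12 j i v).
exact: inj2.
Qed.

(** An edge not inside [R] has an end outside [R], and these ends are distinct because edges of one
    colour are disjoint. *)
Lemma card_restrict R i : trivIset (F i) ->
  #|F i| <= #|restrict F R i| + #|cover (F i) :\: R|.
Proof.
move=> tr.
have -> : #|cover (F i) :\: R| = \sum_(a in F i) \sum_(v in a) (v \notin R).
  rewrite -big_trivIset // -sum1_card big_mkcond [RHS]big_mkcond.
  by apply: eq_bigr => v _; rewrite inE; case: (v \in R); case: (v \in cover _).
rewrite -(cardsID (restrict F R i) (F i)); apply: leq_add.
  exact/subset_leq_card/subsetIr.
rewrite -sum1_card [leqRHS](bigID (mem (restrict F R i))) /=.
apply: leq_trans (leq_addl _ _); rewrite [leqLHS]big_mkcond [leqRHS]big_mkcond /=.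
apply: leq_sum => a _; rewrite !inE; case: (a \in F i) => //=; rewrite ?andbF ?andbT //.
case: ifP => // /subsetPn[v va vR].
by rewrite (bigD1 v) //= vR.
Qed.

End Restrict.

Lemma restrictI (T I : finType) (F : I -> {set {set T}}) R S i :
  restrict (restrict F R) S i = restrict F (R :&: S) i.
Proof. by apply/setP=> a; rewrite !inE subsetI andbA. Qed.

(** The edges chosen so far cover fewer than [2 * #|P|] vertices, each of which blocks at most one
    edge of the next colour. *)
Lemma greedy_rainbow (T I : finType) (F : I -> {set {set T}}) (P : {set I}) :
  simple_family F -> (forall i, i \in P -> 2 * #|P| <= #|F i|) ->
  exists e, rainbow F P e.
Proof.
move=> simF big.
suff /(_ #|P| (leqnn _))[C [e [CP rb cC]]] : forall c, c <= #|P| ->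
    exists (C : {set I}) e, [/\ C \subset P, rainbow F C e & #|C| = c].
  have CP' : C = P by apply/eqP; rewrite eqEcard CP cC leqnn.
  by exists e; rewrite -CP'.
elim=> [|c IH cP].
  exists set0, (fun=> set0); split; rewrite ?sub0set ?cards0 //.
  by split=> [i|i j v]; rewrite inE.
have [C [e [CP [eF inj] cC]]] := IH (ltnW cP).
have /properP[_ [i iP iC]] : C \proper P.
  by rewrite properEcard CP cC.
pose V := \bigcup_(j in C) e j.
have cV : #|V| <= 2 * #|C|.
  by apply: card_bigcup_le => j jC; rewrite (edge_card simF (eF j jC)).
have /card_gt0P[a] : 0 < #|restrict F (~: V) i|.
  have := card_restrict (~: V) (edge_trivIset simF i).
  have : #|cover (F i) :\: ~: V| <= #|V|.
    by apply: subset_leq_card; apply/subsetP=> v; rewrite !inE negbK => /andP[].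
  have := big i iP; rewrite cC in cV; lia.
rewrite inE => /andP[aF /subsetP aV].
have noV j v : j \in C -> v \in e j -> v \in a -> False.
  by move=> jC vj /aV; rewrite inE => /bigcupP; case; exists j.
have iNC j : j \in C -> (j == i) = false by move=> jC; apply: contraNF iC => /eqP <-.
exists (i |: C), (fun j => if j == i then a else e j); split.
- by rewrite subUset sub1set iP.
- split=> [j|j k v].
    by rewrite !inE; case: eqP => [-> //|_ /=]; apply: eF.
  rewrite !inE; case: eqP => [->|_ /=]; case: eqP => [->|_ /=] //.
  + by move=> _ kC va vk; case: (noV k v).
  + by move=> jC _ vj va; case: (noV j v).
  exact: inj.
by rewrite cardsU1 iC cC.
Qed.

(** Three rainbow matchings on disjoint vertex sets are joined: bad colours on [V], nearly all
    others off [W :|: V], and fewer than [s] leftovers inside [W :\: V]. In the last two hypotheses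
    [2 * b] makes up for the edges lost to [V]. *)
Lemma rainbow_of_reservoir (T I : finType) (F : I -> {set {set T}})
    (W : {set T}) (bad : {set I}) K D s b :
  simple_family F -> 0 < s -> #|I| < K * D -> (6 * K).+1 * #|I| <= s * D ->
  #|bad| <= b -> (forall i, 2 * b <= #|F i|) ->
  (forall i, i \notin bad -> 2 * s + 2 * b <= #|restrict F W i|) ->
  (forall i, i \notin bad ->
     #|I| + 2 * D + 2 * b + #|cover (F i) :&: W| <= #|F i|) ->
  exists e, rainbow F setT e.
Proof.
move=> simF s0 IK tI cbad bigF bigW bigR.
have [eB [eBF eBinj]] : exists e, rainbow F bad e.
  apply: greedy_rainbow => // i _; apply: leq_trans (bigF i).
  by rewrite leq_mul2l cbad orbT.
pose V := \bigcup_(i in bad) eB i.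
have cV : #|V| <= 2 * b.
  apply: leq_trans (card_bigcup_le (k := 2) _) _.
    by move=> j jB; rewrite (edge_card simF (eBF j jB)).
  by rewrite leq_mul2l cbad orbT.
have rbB : rainbow (restrict F V) bad eB.
  by split=> // i iB; rewrite inE eBF //=; apply: bigcup_sup.
have cQ : #|~: bad| <= #|I| by apply: max_card.
have [C [e [CQ rbC cC]]] : exists (C : {set I}) e, [/\ C \subset ~: bad,
    rainbow (restrict F (~: (W :|: V))) C e & #|~: bad :\: C| < s].
  apply: (@near_full_rainbow _ _ _ _ K D) => //.
  - exact: restrict_simple.
  - exact: leq_ltn_trans IK.
  - by apply: leq_trans tI; rewrite leq_mul2l cQ orbT.
  move=> j; rewrite inE => jB.
  have := card_restrict (~: (W :|: V)) (edge_trivIset simF j).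
  have := (leq_card_setU (cover (F j) :&: W) V).1.
  have : #|cover (F j) :\: ~: (W :|: V)| <= #|cover (F j) :&: W :|: V|.
    apply: subset_leq_card; apply/subsetP=> v; rewrite !inE negbK.
    by case: (v \in cover _); case: (v \in W); case: (v \in V).
  have := bigR j jB; lia.
have [e' rbP] : exists e, rainbow (restrict F (W :\: V)) (~: bad :\: C) e.
  apply: greedy_rainbow; first exact: restrict_simple.
  move=> i; rewrite !inE => /andP[_ iB].
  have := card_restrict (~: V) (edge_trivIset (restrict_simple W simF) i).
  rewrite restrictI -setDE.
  have : #|cover (restrict F W i) :\: ~: V| <= #|V|.
    by apply: subset_leq_card; apply/subsetP=> v; rewrite !inE negbK => /andP[].
  have := bigW i iB; lia.
have [|e1 rb1] := rainbow_join _ rbB rbC.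
  rewrite disjoint_subset; apply/subsetP=> v vV.
  by rewrite !inE vV orbT.
have [|e2 rb2] := rainbow_join _ rb1 rbP.
  rewrite disjoint_subset; apply/subsetP=> v.
  by rewrite !inE; case: (v \in V); case: (v \in W).
exists e2; have := rainbow_restrictW rb2.
suff -> : bad :|: C :|: (~: bad :\: C) = setT by [].
by apply/setP=> i; rewrite !inE; case: (i \in bad); case: (i \in C).
Qed.

(** * The random reservoir and its second moments *)

Section Reservoir.
Variables (T : finType) (k : nat).
Local Notation N := k.+1.

(* The vertices f sends to 0: for uniformly random f this contains every vertex
   independently with probability 1/N. *)
Definition reservoir (f : {ffun T -> 'I_N}) := [set v | f v == ord0].

(** [f] is prescribed on [A] and free elsewhere: probability [1 / N ^ #|A|], with denominators
    cleared. *)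
Lemma card_reservoir_sub (A : {set T}) :
  N ^ #|A| * #|[set f | A \subset reservoir f]| = N ^ #|T|.
Proof.
have -> : #|[set f | A \subset reservoir f]| = N ^ #|~: A|.
  transitivity #|pffun_on (@ord0 k) (mem (~: A)) (@predT 'I_N)|.
    apply: eq_card => f; rewrite inE; apply/idP/pffun_onP => [/subsetP Af|[sub _]].
      split=> //; apply/subsetP=> v; rewrite !inE; apply: contra => /Af.
      by rewrite inE.
    apply/subsetP=> v vA; rewrite inE; apply: contraTT vA => fv.
    by have := subsetP sub v; rewrite !inE => /(_ fv).
  by rewrite card_pffun_on card_ord.
by rewrite -expnD cardsC.
Qed.

(** [G] will be the edges of a colour or the singletons of its vertices, so that one variance bound
    serves both counts. *)
Definition captured (G : {set {set T}}) f :=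
  #|[set a in G | a \subset reservoir f]|.

Lemma capturedE G f : captured G f = \sum_(a in G) (a \subset reservoir f).
Proof.
rewrite /captured -sum1_card big_mkcond [RHS]big_mkcond /=.
by apply: eq_bigr => a _; rewrite inE; case: (a \in G); case: (a \subset _).
Qed.

Lemma sum_card_pred (S : finType) (P : pred S) : \sum_f P f = #|[set f | P f]|.
Proof.
rewrite -sum1_card big_mkcond [RHS]big_mkcond /=.
by apply: eq_bigr => f _; rewrite inE; case: (P f).
Qed.

Variables (G : {set {set T}}) (r : nat).
Hypothesis Gr : forall a, a \in G -> #|a| = r.
Hypothesis Gtriv : trivIset G.

Lemma captured_moment1 : N ^ r * \sum_f captured G f = #|G| * N ^ #|T|.
Proof.
under eq_bigr do rewrite capturedE.
rewrite exchange_big /= big_distrr /= -sum_nat_const; apply: eq_bigr => a aG.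
by rewrite sum_card_pred -(Gr aG) card_reservoir_sub.
Qed.

(** Disjoint sets are captured independently; a diagonal pair is captured [N ^ r] times as often as
    independence would give. *)
Lemma captured_moment2 :
  N ^ r * N ^ r * \sum_f captured G f ^ 2 <=
  N ^ #|T| * (#|G| * N ^ r + #|G| ^ 2).
Proof.
have pair a b : a \in G -> b \in G ->
    N ^ r * N ^ r * #|[set f | a :|: b \subset reservoir f]| <=
    N ^ #|T| * ((a == b) * N ^ r + 1).
  move=> aG bG; case: eqP => [->|/eqP ab].
    rewrite setUid -mulnA -{2}(Gr bG) card_reservoir_sub mulnC leq_mul2l mul1n.
    by rewrite leq_addr orbT.
  rewrite mul0n muln1 -expnD.
  have -> : r + r = #|a :|: b|.
    rewrite cardsU (Gr aG) (Gr bG) disjoint_setI0 ?cards0 ?subn0 //.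
    by apply: (trivIsetP Gtriv).
  by rewrite card_reservoir_sub.
have -> : \sum_f captured G f ^ 2 =
    \sum_(a in G) \sum_(b in G) #|[set f | a :|: b \subset reservoir f]|.
  under [RHS]eq_bigr do under eq_bigr do rewrite -sum_card_pred.
  under [RHS]eq_bigr do rewrite exchange_big /=.
  rewrite [RHS]exchange_big /=; apply: eq_bigr => f _.
  rewrite capturedE expnS expn1 big_distrlr /=; apply: eq_bigr => a _.
  by apply: eq_bigr => b _; rewrite subUset mulnb.
rewrite big_distrr /=; under eq_bigr do rewrite big_distrr /=.
apply: (@leq_trans (\sum_(a in G) \sum_(b in G) N ^ #|T| * ((a == b) * N ^ r + 1))).
  by apply: leq_sum => a aG; apply: leq_sum => b bG; apply: pair.
rewrite expnS expn1 -mulnDr -sum_nat_const big_distrr /=; apply: leq_sum => a aG.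
rewrite -big_distrr /= leq_mul2l; apply/orP; right.
rewrite big_split /= sum1_card leq_add2r -big_distrl /=.
rewrite (bigD1 a) //= eqxx big1 ?addn0 ?mul1n // => b /andP[_ ba].
by rewrite eq_sym (negPf ba).
Qed.

Local Open Scope ring_scope.

(** Scaled by [N ^ r] the count has mean [#|G|], so this is a variance summed over all [f]; the
    terms in [#|G| ^ 2] cancel. *)
Lemma captured_variance :
  \sum_f ((N ^ r * captured G f)%:Z - #|G|%:Z) ^+ 2 <=
  (N ^ #|T| * (#|G| * N ^ r))%:Z.
Proof.
have -> : \sum_f ((N ^ r * captured G f)%:Z - #|G|%:Z) ^+ 2 =
    (N ^ r * N ^ r * \sum_f captured G f ^ 2)%:Z
    - (2 * #|G| * (N ^ r * \sum_f captured G f))%:Z + (N ^ #|T| * #|G| ^ 2)%:Z.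
  rewrite -[(N ^ #|T|)%N](_ : #|{ffun T -> 'I_N}| = _)%N; last first.
    by rewrite card_ffun card_ord.
  rewrite -sum_nat_const mulnA !big_distrr /= !(big_morph Posz PoszD (erefl _)).
  rewrite -sumrB -big_split /=; apply: eq_bigr => f _.
  move: (N ^ r)%N (captured G f) #|G| => x y z.
  by rewrite -!mulnn !PoszM; ring.
rewrite captured_moment1; have := captured_moment2.
rewrite expnS expn1; move: (N ^ r * N ^ r * \sum_f captured G f ^ 2)%N (N ^ r)%N (N ^ #|T|)%N #|G|.
by move=> a b c g; nia.
Qed.

End Reservoir.

(** Chebyshev for all colours at once: some [f] has [Phi f] at most the average, and every bad
    colour adds at least [n ^ 2] to it. *)
Lemma exists_reservoir (T I : finType) (F : I -> {set {set T}}) n N :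
  simple_family F -> 0 < N -> (forall i, #|F i| = n) -> #|I| <= n ->
  exists W : {set T},
    #|[set i | (2 * N ^ 2 * #|restrict F W i| < n) ||
               (4 * n < N * #|cover (F i) :&: W|)]| <= 6 * N ^ 2.
Proof.
case: N => // k simF _ Fn In; set N := k.+1.
case: (posnP n) => [n0|n0].
  exists set0; apply: leq_trans (max_card _) _; apply: leq_trans In _.
  by rewrite n0.
pose G1 i := [set [set v] | v in cover (F i)].
have cG1 i : #|G1 i| = 2 * n.
  rewrite card_imset; last exact: set1_inj.
  have /eqP <- := edge_trivIset simF i.
  rewrite (eq_bigr (fun=> 2)) => [|a]; last by move/(edge_card simF).
  by rewrite sum_nat_const Fn mulnC.
have G1r i a : a \in G1 i -> #|a| = 1.
  by case/imsetP=> v _ ->; rewrite cards1.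
have G1triv i : trivIset (G1 i).
  apply/trivIsetP=> _ _ /imsetP[u _ ->] /imsetP[v _ ->] uv.
  by rewrite disjoints1 inE; apply: contra uv => /eqP->.
have capG1 i f : captured (G1 i) f = #|cover (F i) :&: reservoir f|.
  rewrite -(card_imset _ set1_inj); apply: eq_card => a; rewrite !inE.
  apply/andP/imsetP => [[/imsetP[v vF ->]]|[v]].
    by rewrite sub1set => vf; exists v; rewrite // inE vF.
  by rewrite inE => /andP[vF vf] ->; rewrite sub1set imset_f.
(* The factor 4 is there because a bad scaled edge count may be off by little more than [n / 2]; a
   bad scaled vertex count is off by more than [2 * n]. *)
pose Phi (f : {ffun T -> 'I_N}) : int := (\sum_i
  (4 * ((N ^ 2 * captured (F i) f)%:Z - n%:Z) ^+ 2 +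
   ((N ^ 1 * captured (G1 i) f)%:Z - (2 * n)%:Z) ^+ 2))%R.
(* On average a colour adds at most [4 * n * N ^ 2 + 2 * n * N <= 6 * n * N ^ 2], and there are at
   most [n] colours. *)
pose c := 6 * n ^ 2 * N ^ 2.
have sumPhi : (\sum_f Phi f <= (N ^ #|T| * c)%:Z)%R.
  rewrite exchange_big /=.
  apply: (@le_trans _ _ (\sum_(i : I) (N ^ #|T| * (6 * n * N ^ 2))%:Z)%R).
    apply: ler_sum => i _; rewrite big_split /= -mulr_sumr.
    have := captured_variance k (fun a => @edge_card _ _ _ simF i a) (edge_trivIset simF i).
    have := captured_variance k (G1r i) (G1triv i).
    rewrite cG1 Fn -/N => v1 v2.
    have NN : N ^ 1 <= N ^ 2 by rewrite leq_pexp2l.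
    apply: le_trans (lerD (ler_wpM2l _ v2) v1) _ => //.
    by move: (N ^ #|T|) (N ^ 2) (N ^ 1) NN => M x y /(leq_mul (leqnn (M * n))); lia.
  rewrite sumr_const pmulrn mulrzz -PoszM /c.
  move: (N ^ #|T|) (N ^ 2) #|I| In => M x p In; nia.
have [f Phif] : exists f, (Phi f <= c%:Z)%R.
  apply: contrapT => no.
  have lt f : ((c.+1)%:Z <= Phi f)%R.
    rewrite leNgt; apply/negP => lt; apply: no; exists f.
    by move: lt; rewrite -addn1 PoszD ltzD1.
  have := le_trans (ler_sum _ (fun f _ => lt f)) sumPhi.
  rewrite sumr_const card_ffun card_ord pmulrn mulrzz -PoszM lez_nat.
  by apply/negP; rewrite -ltnNge (mulnC c.+1) ltn_mul2l ltnS leqnn expn_gt0.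
exists (reservoir f); set bad := [set i | _].
have : ((#|bad| * n ^ 2)%:Z <= c%:Z)%R.
  apply: le_trans Phif; rewrite PoszM mulrC -mulrzz -pmulrn -sumr_const.
  rewrite big_mkcond /=; apply: ler_sum => i _.
  rewrite !inE capG1 -/(captured _ _) expn1.
  case: ifP => [|_]; last first.
    by apply: addr_ge0; [apply: mulr_ge0 => //|]; apply: sqr_ge0.
  rewrite -(mulnn n) !expr2; move: (captured (F i) f) (#|cover (F i) :&: _|) (N ^ 2) => X Y M.
  have sq (u : int) : (0 <= u * u)%R by rewrite -expr2 sqr_ge0.
  case/orP => lt.
    apply: ler_wpDr; first exact: sq.
    by have : (n%:Z <= 2 * (n%:Z - (M * X)%:Z))%R; [lia | nia].
  apply: ler_wpDl; first by rewrite mulr_ge0.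
  by have : (n%:Z <= (N * Y)%:Z - (2 * n)%:Z)%R; [lia | nia].
rewrite lez_nat /c [6 * _ * _]mulnAC leq_mul2r expn_eq0.
by rewrite eqn0Ngt n0.
Qed.

(** * Choice of the parameters *)

(** Here [q] stands for n^c and [d] for n - m. With [N = 16 * q] the reservoir takes at most [d / 4]
    vertices of a colour that is not bad. *)
Lemma full_rainbow (T I : finType) (F : I -> {set {set T}}) n d q L :
  simple_family F -> (forall i, #|F i| = n) -> 0 < n -> #|I| + d <= n ->
  n <= q * d -> 64 * 64 * 64 * 64 <= L -> L * q ^ 4 <= n ->
  exists e, rainbow F setT e.
Proof.
move=> simF Fn n0 In nqd L64 Lq.
have q0 : 0 < q by case: q nqd {Lq} => //; rewrite mul0n leqNgt n0.
have d0 : 0 < d by case: d nqd {In} => //; rewrite muln0 leqNgt n0.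
pose a := q * q.
have a0 : 0 < a by rewrite muln_gt0 q0.
have aan : 64 * 64 * 64 * 64 * (a * a) <= n.
  have <- : q ^ 4 = a * a by rewrite /a !expnS muln1 !mulnA.
  by apply: leq_trans Lq; rewrite leq_mul2r L64 orbT.
have aqd : 64 * 64 * 64 * 64 * (a * q) <= d.
  rewrite -(leq_pmul2l q0); apply: leq_trans nqd; apply: leq_trans aan.
  by rewrite [leqRHS](_ : _ = q * (64 * 64 * 64 * 64 * (a * q))) // /a; ring.
have aa : a <= a * a by rewrite leq_pmulr.
have aq : a <= a * q by rewrite leq_pmulr.
have N0 : 0 < 16 * q by rewrite muln_gt0.
have [W cbad] := exists_reservoir simF N0 Fn (leq_trans (leq_addr _ _) In).
have b2 : (16 * q) ^ 2 = 256 * a by rewrite -mulnn /a; ring.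
rewrite b2 in cbad.
(* Rounding [d / 8] up makes [2 * D] about a quarter of [d]. *)
pose D := (d + 7) %/ 8.
have [D1 D2] : d <= 8 * D /\ 8 * D <= d + 7 by rewrite /D; lia.
have qD : q * d <= q * (8 * D) by rewrite leq_mul2l D1 orbT.
(* [K = 8 * q] gives [n <= K * D]; [392 = 8 * 49] comes from [6 * K + 1 <= 49 * q] and
   [#|I| <= 8 * q * D]; [b] is [6 * N ^ 2]. *)
apply: (@rainbow_of_reservoir _ _ F W _ (8 * q) D (392 * a) (6 * (256 * a)) simF _ _ _ cbad).
- by rewrite muln_gt0.
- by clearbody D a; lia.
- have h1 : q * #|I| <= q * (q * (8 * D)) by rewrite leq_mul2l; apply/orP; right; lia.
  have h2 : #|I| <= q * #|I| by rewrite leq_pmull.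
  by rewrite /a; lia.
- by move=> i; rewrite Fn; clearbody a; lia.
- move=> i; rewrite inE negb_or -leqNgt => /andP[nX _].
  rewrite leqNgt; apply/negP => lt.
  have : a * #|restrict F W i| <= a * (3856 * a).
    by rewrite leq_mul2l; apply/orP; right; lia.
  by move: nX aan; clearbody a; move: #|_| => X; lia.
move=> i; rewrite inE negb_or -!leqNgt Fn => /andP[_ nY].
have : 4 * #|cover (F i) :&: W| <= d.
  by rewrite -(leq_pmul2l q0); move: nY; move: #|_| => Y; lia.
by clearbody a D; move: #|_ :&: _| => Y; lia.
Qed.

(** * Full rainbow matchings as edge sets, and the real exponent *)

Lemma full_rainbow_matching_of_rainbow (T : finType) m
    (F : 'I_m -> {set {set T}}) e :
  simple_family F -> rainbow F setT e ->
  full_rainbow_matching F [set e i | i : 'I_m].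
Proof.
move=> simF [eF inj]; split.
- apply/andP; split.
    by apply/forall_inP=> _ /imsetP[i _ ->]; rewrite (edge_card simF (eF i (in_setT i))).
  apply/trivIsetP=> _ _ /imsetP[i _ ->] /imsetP[j _ ->] ij.
  rewrite disjoint_subset; apply/subsetP=> v vi; rewrite inE; apply: contra ij => vj.
  by rewrite (inj i j v).
- apply/subsetP=> _ /imsetP[i _ ->]; apply/bigcupP; exists i => //; exact: eF.
move=> i; apply/eqP/cards1P; exists (e i); apply/setP=> a; rewrite !inE.
apply/andP/eqP => [[/imsetP[j _ ->] ji]|->].
  by rewrite (edge_color simF (eF j (in_setT j)) ji).
by split; [apply: imset_f | apply: eF].
Qed.

Lemma non_intersecting_simple (T : finType) m (F : 'I_m -> {set {set T}}) :
  (forall i, matching (F i)) -> non_intersecting F -> simple_family F.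
Proof.
move=> mF nF; split=> // i j a ai aj; apply/val_inj/eqP; apply: contraT.
rewrite neq_ltn => /orP[] /nF/setP/(_ a); rewrite !inE ai aj //.
Qed.

Local Open Scope ring_scope.

Theorem theorem2p2 (R : realType) (c : R) (hc0 : 0 < c) (hc1 : c < 1 / 10) :
  exists n0 : nat, forall n : nat, (n0 <= n)%N ->
  forall (T : finType) (m : nat) (F : 'I_m -> {set {set T}}),
    (forall i : 'I_m, matching (F i)) ->
    (forall i : 'I_m, #|F i| = n) ->
    non_intersecting F ->
    m%:R <= (1 - n%:R `^ (- c)) * n%:R ->
    exists M : {set {set T}}, full_rainbow_matching F M.
Proof.
have [L L64] : exists L, (64 * 64 * 64 * 64 <= L)%N by eexists; apply: leqnn.
have L1 : (0 < L)%N by apply: leq_trans L64; rewrite !muln_gt0.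
(* Both [16 * L] and [y ^ 4] are then at most the square root of [n], so
   [L * q ^ 4 <= 16 * L * y ^ 4 <= n]. *)
exists (16 * L * (16 * L))%N => n Ln T m F mF Fn nF mn.
have n0 : (0 < n)%N by apply: leq_trans Ln; rewrite !muln_gt0 L1.
set y : R := n%:R `^ c.
have n1 : 1 <= n%:R :> R by rewrite ler1n.
have y1 : 1 <= y by rewrite -(powRr0 n%:R) ler_powR // ltW.
have y10 : y ^+ 10 <= n%:R.
  rewrite -powR_mulrn ?powR_ge0 // -powRrM -[leRHS]powRr1 ?ler0n //.
  by rewrite ler_powR //; lra.
have y0 : 0 <= y by apply: le_trans y1.
have mnN : (m <= n)%N.
  rewrite -(ler_nat R); apply: le_trans mn _.
  by rewrite ler_piMl ?ler0n // lerBlDr lerDl powR_ge0.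
(* The bound on [m] becomes [n <= y * d], and [q] is an integer with [y < q <= 2 * y]. *)
pose d := (n - m)%N; pose q := (Num.truncn y).+1.
have dE : d%:R = n%:R - m%:R :> R by rewrite natrB.
have nyd : n%:R <= y * d%:R.
  have yp : 0 < y by apply: lt_le_trans y1.
  rewrite -ler_pdivrMl // dE -powRN lerBrDl -lerBrDr.
  by apply: le_trans mn _; rewrite mulrBl mul1r.
have qy : y < q%:R by apply: truncnS_gt.
have q2y : q%:R <= 2 * y.
  have : (Num.truncn y)%:R <= y by rewrite truncn_le.
  by rewrite /q -addn1 natrD; lra.
have simF := non_intersecting_simple mF nF.
have [e rb] : exists e, rainbow F setT e.
  apply: (@full_rainbow _ _ F n d q L) => //.
  - by rewrite card_ord subnKC.
  - rewrite -(ler_nat R) natrM; apply: le_trans nyd _.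
    by rewrite ler_wpM2r ?ler0n // ltW.
  rewrite -(ler_nat R) natrM natrX.
  have y8 : (y ^+ 4) ^+ 2 <= n%:R.
    by rewrite -exprM; apply: le_trans y10; rewrite ler_weXn2l.
  have L2 : (16 * L%:R) ^+ 2 <= n%:R :> R.
    by rewrite -natrM -natrX ler_nat -mulnn.
  have q4 : q%:R ^+ 4 <= 16 * y ^+ 4 :> R.
    apply: le_trans (_ : (2 * y) ^+ 4 <= _); first by rewrite lerXn2r ?nnegrE ?mulr_ge0.
    by rewrite exprMn -natrX.
  apply: le_trans (_ : L%:R * (16 * y ^+ 4) <= _); first by rewrite ler_wpM2l.
  rewrite mulrCA mulrA -(@ler_pXn2r _ 2) ?nnegrE ?mulr_ge0 ?exprn_ge0 //.
  rewrite exprMn expr2 ler_pM ?exprn_ge0 // -?expr2 ?sqr_ge0 //.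
by exists [set e i | i : 'I_m]; apply: full_rainbow_matching_of_rainbow.
Qed.
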